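(* Let the loss $f(\cdot,z)$ be convex and $\beta$-smooth for all $z\in\mathcal{Z}$, and run full-batch GD for $T$ iterations with $\eta_t=1/(2\beta)$ for all $t\in\{1,\dots,T\}$. Then $$|\epsilon_{\mathrm{gen}}|\le8\left(\frac1n+\frac{2T}{n^2}\right)\left(3\beta\,\mathbb{E}[\|W_1-W^*_S\|_2^2]+T\epsilon_{\mathbf{c}}\right),$$ and $$\epsilon_{\mathrm{excess}}\le8\left(\frac1n+\frac{2T}{n^2}\right)\left(3\beta\,\mathbb{E}[\|W_1-W^*_S\|_2^2]+T\epsilon_{\mathbf{c}}\right)+\frac{3\beta\,\mathbb{E}[\|W_1-W^*_S\|_2^2]}{T}.$$
   Context: Let $\mathcal{D}$ be a distribution on $\mathcal{Z}$ and $z_1,\dots,z_n$ i.i.d. from $\mathcal{D}$; $S=(z_1,\dots,z_n)$. The loss $f:\mathbb{R}^d\times\mathcal{Z}\to[0,\infty)$ is non-negative; $\beta$-smooth means $\|\nabla f(w,z)-\nabla f(u,z)\|_2\le\beta\|w-u\|_2$. $R(w)=\mathbb{E}_{Z\sim\mathcal{D}}[f(w,Z)]$ with minimum value $R^*=R(w^* )$, $w^*\in\arg\min_w R(w)$ (assumed to exist); $R_S(w)=\frac1n\sum_j f(w,z_j)$, $W^*_S$ a minimizer of $R_S$ (assumed to exist). Full-batch GD: from a fixed $W_1$, $W_{t+1}=W_t-\frac{\eta_t}{n}\sum_{j=1}^n\nabla f(W_t,z_j)$, $t=1,\dots,T$, output $A(S)=W_{T+1}$. Definitions: $\epsilon_{\mathrm{gen}}=\mathbb{E}[R(A(S))-R_S(A(S))]$;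 excess risk $\epsilon_{\mathrm{excess}}=\mathbb{E}[R(A(S))]-R^*$; $\epsilon_{\mathbf{c}}=\mathbb{E}[R_S(W^*_S)]$. *)

(* Defs.v *)
From HB Require Import structures.
From mathcomp Require Import all_boot all_order all_algebra.
From mathcomp Require Import all_classical all_reals.
From mathcomp Require Import topology normedtype derive convex measure lebesgue_measure lebesgue_integral probability.
Set Implicit Arguments. Unset Strict Implicit. Unset Printing Implicit Defensive.
Import Order.TTheory GRing.Theory Num.Theory.
Import numFieldNormedType.Exports.
Local Open Scope classical_set_scope.
Local Open Scope ring_scope.

Definition dotv {R : realType} {d : nat} (u v : 'rV[R]_d) : R :=
  \sum_(i < d) u ord0 i * v ord0 i.
Definition norm2 {R : realType} {d : nat} (v : 'rV[R]_d) : R :=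
  Num.sqrt (dotv v v).

Definition is_gradient {R : realType} {d : nat}
    (F : 'rV[R]_d -> R) (g : 'rV[R]_d -> 'rV[R]_d) : Prop :=
  forall w, differentiable F w /\ forall h, 'd F w h = dotv (g w) h.

Definition smooth_with {R : realType} {d : nat} (beta : R)
    (g : 'rV[R]_d -> 'rV[R]_d) : Prop :=
  forall w u, norm2 (g w - g u) <= beta * norm2 (w - u).

(* Full-batch gradient descent with constant step size eta started at W1:
   gd_iter g eta W1 s k = W_{k+1}  (so gd_iter ... 0 = W_1). *)
Fixpoint gd_iter {R : realType} {d : nat} {Z : Type} {n : nat}
    (g : 'rV[R]_d -> Z -> 'rV[R]_d) (eta : R) (W1 : 'rV[R]_d)
    (s : 'I_n -> Z) (k : nat) : 'rV[R]_d :=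
  match k with
  | 0 => W1
  | k'.+1 =>
      let W := gd_iter g eta W1 s k' in
      W - (eta / n%:R) *: \sum_(j < n) g W (s j)
  end.

Definition emp_risk {R : realType} {d : nat} {Z : Type} {n : nat}
    (f : 'rV[R]_d -> Z -> R) (s : 'I_n -> Z) (w : 'rV[R]_d) : R :=
  n%:R^-1 * \sum_(j < n) f w (s j).

Definition pop_risk {R : realType} {d : nat} {dz : measure_display}
    {Z : measurableType dz} (D : probability Z R)
    (f : 'rV[R]_d -> Z -> R) (w : 'rV[R]_d) : \bar R :=
  (\int[D]_z (f w z)%:E)%E.

Definition mutually_independent {R : realType} {dO dz : measure_display}
    {Omega : measurableType dO} {Z : measurableType dz} {n : nat}
    (P : probability Omega R) (X : 'I_n -> Omega -> Z) : Prop :=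
  forall A : 'I_n -> set Z, (forall i, measurable (A i)) ->
    P (\bigcap_(i in [set: 'I_n]) (X i @^-1` A i)) =
    (\prod_(i < n) P (X i @^-1` A i))%E.

Definition iid_sample {R : realType} {dO dz : measure_display}
    {Omega : measurableType dO} {Z : measurableType dz} {n : nat}
    (P : probability Omega R) (D : probability Z R) (X : 'I_n -> Omega -> Z) : Prop :=
  (forall j, measurable_fun setT (X j)) /\
  mutually_independent P X /\
  (forall j (A : set Z), measurable A -> P (X j @^-1` A) = D A).

(* Main.v *)
Require Import Defs.
From HB Require Import structures.
From mathcomp Require Import all_boot all_order all_algebra.
From mathcomp Require Import all_classical all_reals.
From mathcomp Require Import topology normedtype derive convex measure lebesgue_measure lebesgue_integral probability.
From mathcomp Require Import interval_inference measurable_realfun sequences ring lra.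
Import Order.TTheory GRing.Theory Num.Theory.
Import numFieldNormedType.Exports.
Local Open Scope classical_set_scope.
Local Open Scope ring_scope.

(** Replace the [i]-th sample point by an independent copy [z_i']. By exchangeability the
    generalization gap is the mean over [i] of
    [E (f (A S^(i)) z_i - f (A S) z_i)]. A gradient step of size [1 / (2 beta)] is
    nonexpansive for each one-sample loss, so the two runs drift apart only through the
    gradients at [z_i] and [z_i'], and nonnegativity gives [|grad f|^2 <= 4 beta f]. Hence
    the gap is controlled by the sum over the iterates of the expected empirical risk, which
    the usual telescoping regret bound of gradient descent compares with the empirical
    minimum. *)

(** * Tangent inequalities for convex smooth functions *)

(** The stability bound has to be linear in the losses: products of gradient norms are split by
    Young's inequality until every term is the loss of one run at a point of its own sample. The
    exchange preserves the means of such terms, so one sequence of expected losses controls the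
    whole bound. Finiteness of expectations is part of the argument. It starts from the finite risk
    of [wstar], passes to [W1] by a quadratic growth bound, to the iterates by descent of the
    empirical risk, and to the population risk of the output by the stability bound itself. The
    expected squared distance may still be infinite, which is a separate case. [Omega] may carry no
    independent copy of a sample point, so the copy lives on the second factor of [Omega * Omega].
    The weaker smoothness constant is affordable: the step [(2 * b)^-1] exactly minimises the
    resulting quadratic upper bound, and the argument yields [4 / n + 4 T / n^2] times
    [2 beta E |W1 - WS|^2 + T eps_c], with excess term [beta / T], all below the stated
    constants. *)

Section euclidean.
Context {R : realType} {d : nat}.
Implicit Types u v w : 'rV[R]_d.

Lemma dotvC u v : dotv u v = dotv v u.
Proof. by apply: eq_bigr => i _; rewrite mulrC. Qed.

Lemma dotvDl u v w : dotv (u + v) w = dotv u w + dotv v w.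
Proof. by rewrite -big_split/=; apply: eq_bigr => i _; rewrite mxE mulrDl. Qed.

Lemma dotvZl (a : R) u v : dotv (a *: u) v = a * dotv u v.
Proof. by rewrite mulr_sumr; apply: eq_bigr => i _; rewrite mxE mulrA. Qed.

Lemma dotvDr u v w : dotv u (v + w) = dotv u v + dotv u w.
Proof. by rewrite dotvC dotvDl !(dotvC u). Qed.

Lemma dotvZr (a : R) u v : dotv u (a *: v) = a * dotv u v.
Proof. by rewrite dotvC dotvZl dotvC. Qed.

Lemma dotvNl u v : dotv (- u) v = - dotv u v.
Proof. by rewrite -scaleN1r dotvZl mulN1r. Qed.

Lemma dotvNr u v : dotv u (- v) = - dotv u v.
Proof. by rewrite dotvC dotvNl dotvC. Qed.

Lemma dotv_suml (I : Type) (r : seq I) (F : I -> 'rV[R]_d) v :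
  dotv (\sum_(i <- r) F i) v = \sum_(i <- r) dotv (F i) v.
Proof.
elim: r => [|i r IH]; last by rewrite !big_cons dotvDl IH.
by rewrite !big_nil -(scale0r 0) dotvZl mul0r.
Qed.

Definition dotvE := (dotvDl, dotvDr, dotvNl, dotvNr, dotvZl, dotvZr).

Lemma dotv_ge0 u : 0 <= dotv u u.
Proof. by apply: sumr_ge0 => i _; rewrite -expr2 sqr_ge0. Qed.

Lemma norm2_ge0 u : 0 <= norm2 u.
Proof. exact: sqrtr_ge0. Qed.

Lemma norm2_sq u : norm2 u ^+ 2 = dotv u u.
Proof. by rewrite sqr_sqrtr// dotv_ge0. Qed.

Lemma norm2Z (a : R) u : norm2 (a *: u) = `|a| * norm2 u.
Proof. by rewrite /norm2 dotvZl dotvZr mulrA -expr2 sqrtrM ?sqr_ge0// sqrtr_sqr. Qed.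

Lemma norm2N u : norm2 (- u) = norm2 u.
Proof. by rewrite -scaleN1r norm2Z normrN normr1 mul1r. Qed.

Lemma norm2_0 : norm2 (0 : 'rV[R]_d) = 0.
Proof. by rewrite -(scale0r 0) norm2Z normr0 mul0r. Qed.

Lemma dotv_le_norm2 u v : dotv u v <= norm2 u * norm2 v.
Proof.
have [u0|u0] := eqVneq (dotv u u) 0.
  suff -> : u = 0 by rewrite norm2_0 mul0r -(scale0r 0) dotvZl mul0r.
  apply/rowP => i; rewrite mxE; apply/eqP.
  have /eqP := u0; rewrite psumr_eq0; last by move=> j _; rewrite -expr2 sqr_ge0.
  by move=> /allP/(_ i (mem_index_enum _)); rewrite mulf_eq0 orbb.
have {}u0 : 0 < dotv u u by rewrite lt_neqAle eq_sym u0 dotv_ge0.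
apply: le_trans (ler_norm _) _; rewrite -sqrtr_sqr /norm2 -sqrtrM ?dotv_ge0//.
rewrite ler_wsqrtr// -subr_ge0 -(pmulr_rge0 _ u0).
have := dotv_ge0 (dotv u u *: v - dotv u v *: u).
rewrite !dotvE (dotvC v u) => h; apply: le_trans h _.
by rewrite le_eqVlt; apply/orP; left; apply/eqP; ring.
Qed.

Lemma norm2D u v : norm2 (u + v) <= norm2 u + norm2 v.
Proof.
rewrite -(ler_pXn2r (ltn0Sn 1)) ?nnegrE ?addr_ge0 ?norm2_ge0//.
rewrite sqrrD !norm2_sq !dotvE (dotvC v u).
have := dotv_le_norm2 u v; lra.
Qed.

Lemma norm2_sum (I : Type) (r : seq I) (p : pred I) (F : I -> 'rV[R]_d) :
  norm2 (\sum_(i <- r | p i) F i) <= \sum_(i <- r | p i) norm2 (F i).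
Proof.
elim/big_rec2: _ => [|i x u _ h]; first by rewrite norm2_0.
by apply: le_trans (norm2D _ _) _; rewrite lerD2l.
Qed.

Lemma norm_coord_le_norm2 u (i : 'I_d) : `|u ord0 i| <= norm2 u.
Proof.
rewrite -sqrtr_sqr ler_wsqrtr// /dotv (bigD1 i)//= expr2 lerDl.
by apply: sumr_ge0 => j _; rewrite -expr2 sqr_ge0.
Qed.

Lemma norm2_le_sum u : norm2 u <= \sum_(i < d) `|u ord0 i|.
Proof.
rewrite {1}[u]row_sum_delta; apply: le_trans (norm2_sum _ _ _ _) _.
apply: ler_sum => i _; rewrite norm2Z ler_piMr// /norm2 /dotv (bigD1 i)//= big1 => [|j ji].
  by rewrite !mxE !eqxx mul1r addr0 sqrtr1.
by rewrite !mxE (negbTE ji) andbF mul0r.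
Qed.

End euclidean.

Section sandwich.
Context {R : realType} {d : nat}.
Implicit Types (F : 'rV[R]_d -> R) (G : 'rV[R]_d -> 'rV[R]_d).

(* For a convex function with [b]-Lipschitz gradient the sharp constant would be [b / 2];
   [b] follows from the two tangent inequalities alone and is sufficient here. *)
Definition sandwich F G (b : R) := forall w u,
  F w + dotv (G w) (u - w) <= F u <=
  F w + dotv (G w) (u - w) + b * norm2 (u - w) ^+ 2.

(** Convexity bounds each difference quotient of [F] from [w] towards [u] by [F u - F w]. A larger
    directional derivative would make the quotients exceed this value for small steps. *)
Lemma convex_tangent F G :
  convex_function setT F -> is_gradient F G ->
  forall w u, F w + dotv (G w) (u - w) <= F u.
Proof.
move=> cF gF w u; have [dF gE] := gF w.
rewrite -gE -deriveE// -lerBrDl leNgt; apply/negP => /[dup] lt.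
have /(_ (u - w)) dD := diff_derivable dF.
move: dD => /cvgr_gt /[apply] /= near_gt.
have /= [e e0 He] := near_gt.
(* Halving [e] puts [t] strictly inside the neighbourhood; the cap at 1 makes it a convexity
   weight. *)
pose t := Num.min 1 (e / 2).
have t0 : 0 < t by rewrite lt_min ltr01/= divr_gt0.
have t1 : t <= 1 by rewrite ge_min lexx.
have te : t < e.
  by rewrite gt_min; apply/orP; right; rewrite ltr_pdivrMr// ltr_pMr// ltr1n.
have := He t.
rewrite /= sub0r normrN gtr0_norm// => /(_ te); rewrite gt_eqF// => /(_ isT).
rewrite /GRing.scale/= ltNge => /negP; apply.
rewrite mulrC ler_pdivrMr//.
have t01 : 0 <= t <= 1 by rewrite ltW.
pose ti := Itv01 (ltW t0) t1.
have := cF ti u w (in_setT _) (in_setT _).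
rewrite convRE /=.
have -> : (conv ti (u : convex_lmodType 'rV[R]_d) w : 'rV[R]_d) = t *: (u - w) + w.
  rewrite /conv/= /convex.conv/= /unstable.onem scalerBr scalerBl scale1r addrAC addrA //.
rewrite /unstable.onem. set x := F (_ + _). lra.
Qed.

(** For the upper half, the tangent inequality at [u] evaluated at [w] leaves
    [dotv (G u - G w) (u - w)], which Cauchy-Schwarz and the Lipschitz bound control. *)
Lemma convex_smooth_sandwich F G b :
  convex_function setT F -> is_gradient F G -> smooth_with b G ->
  sandwich F G b.
Proof.
move=> cF gF sG w u; have ct := convex_tangent _ _ cF gF; apply/andP; split=> //.
have := ct u w.
have : dotv (G u - G w) (u - w) <= b * norm2 (u - w) ^+ 2.
  apply: le_trans (dotv_le_norm2 _ _) _.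
  by rewrite expr2 mulrA ler_wpM2r ?norm2_ge0.
rewrite !dotvE; lra.
Qed.

End sandwich.

Section sandwich_theory.
Context {R : realType} {d : nat}.
Implicit Types (F : 'rV[R]_d -> R) (G : 'rV[R]_d -> 'rV[R]_d).
Variables (b : R).
Hypothesis b0 : 0 < b.

(** The step [(2 * b)^-1 *: G w] minimises the quadratic upper bound at [w] and lowers it by
    [|G w|^2 / (4 b)], yet [F] cannot fall below [m]. *)
Lemma sandwich_grad_le F G (m : R) : sandwich F G b -> (forall u, m <= F u) ->
  forall w, norm2 (G w) ^+ 2 <= 4 * b * (F w - m).
Proof.
move=> sF mF w; have := mF (w - (2 * b)^-1 *: G w).
have /andP[_] := sF w (w - (2 * b)^-1 *: G w).
have -> : w - (2 * b)^-1 *: G w - w = - ((2 * b)^-1 *: G w) by rewrite addrAC subrr add0r.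
rewrite norm2_sq !dotvE -norm2_sq => h1 h2.
have := le_trans h2 h1.
have -> : F w + - ((2 * b)^-1 * norm2 (G w) ^+ 2) +
  b * - - ((2 * b)^-1 * ((2 * b)^-1 * norm2 (G w) ^+ 2)) =
  F w - (4 * b)^-1 * norm2 (G w) ^+ 2.
  by field; rewrite gt_eqF.
rewrite lerBrDl addrC -lerBrDl ler_pdivrMl ?mulr_gt0//.
Qed.

(** Subtracting the linear form [dotv (G w)] from [F] keeps the sandwich and makes [w] a minimiser,
    so [sandwich_grad_le] applies to the tilted function. Averaging with the roles of [u] and [w]
    exchanged cancels the values of [F]. *)
Lemma sandwich_cocoercive F G : sandwich F G b ->
  forall w u, norm2 (G u - G w) ^+ 2 <= 2 * b * dotv (G u - G w) (u - w).
Proof.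
move=> sF.
have half w u : norm2 (G u - G w) ^+ 2 <= 4 * b * (F u - F w - dotv (G w) (u - w)).
  have := @sandwich_grad_le (fun v => F v - dotv (G w) v) (fun v => G v - G w)
    (F w - dotv (G w) w).
  move=> /(_ _ _ u).
  have -> : F u - dotv (G w) u - (F w - dotv (G w) w) = F u - F w - dotv (G w) (u - w).
    by rewrite !dotvE; ring.
  apply=> [v v'|v].
    have := sF v v'; rewrite !dotvE => /andP[? ?]; apply/andP; split; lra.
  by have := sF w v; rewrite !dotvE => /andP[? ?]; lra.
move=> w u; have h1 := half w u; have h2 := half u w.
have E : norm2 (G w - G u) = norm2 (G u - G w) by rewrite -norm2N opprB.
rewrite E in h2.
have -> : 2 * b * dotv (G u - G w) (u - w) = 2^-1 * (4 * b * (F u - F w - dotv (G w) (u - w)) +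
   4 * b * (F w - F u - dotv (G u) (w - u))).
  by rewrite !dotvE; field.
lra.
Qed.

Lemma sandwich_step_nonexpansive F G : sandwich F G b -> forall w u,
  norm2 ((u - (2 * b)^-1 *: G u) - (w - (2 * b)^-1 *: G w)) <= norm2 (u - w).
Proof.
move=> sF w u; rewrite -(ler_pXn2r (ltn0Sn 1)) ?nnegrE ?norm2_ge0//.
have -> : u - (2 * b)^-1 *: G u - (w - (2 * b)^-1 *: G w) =
          (u - w) - (2 * b)^-1 *: (G u - G w).
  by rewrite scalerBr !opprB addrACA [in RHS]addrACA; congr (_ + _); rewrite addrC.
rewrite !norm2_sq; have := sandwich_cocoercive _ _ sF w u.
rewrite norm2_sq; move: (u - w) (G u - G w) => D H h.
rewrite !dotvE (dotvC D H).
have : (2 * b)^-1 * ((2 * b)^-1 * dotv H H) <= (2 * b)^-1 * dotv H D.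
  by rewrite ler_pM2l ?invr_gt0 ?mulr_gt0// ler_pdivrMl ?mulr_gt0.
have : 0 <= (2 * b)^-1 * ((2 * b)^-1 * dotv H H).
  by rewrite !mulr_ge0 ?dotv_ge0 ?invr_ge0// ?mulr_ge0 ?ltW.
lra.
Qed.

(** The upper bound at the new point and the tangent bound at [u] combine by polarisation, since
    [G w] is [2 * b] times the displacement. The squared distances telescope along a run, and
    [u := w] gives descent. *)
Lemma sandwich_step F G : sandwich F G b -> forall w u,
  F (w - (2 * b)^-1 *: G w) <= F u + b * norm2 (w - u) ^+ 2 -
    b * norm2 (w - (2 * b)^-1 *: G w - u) ^+ 2.
Proof.
move=> sF w u; set v := w - _ *: _.
have /andP[_ h1] := sF w v; have /andP[h2 _] := sF w u.
have GE : G w = (2 * b) *: (w - v).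
  by rewrite /v subKr scalerA mulfV ?scale1r// gt_eqF// mulr_gt0.
move: h1 h2; rewrite GE; clearbody v => h1 h2.
have -> : F u + b * norm2 (w - u) ^+ 2 - b * norm2 (v - u) ^+ 2 =
  F u - dotv (2 * b *: (w - v)) (u - w) + dotv (2 * b *: (w - v)) (v - w) + b * norm2 (v - w) ^+ 2.
  rewrite !norm2_sq !dotvE (dotvC u w) (dotvC v w) (dotvC v u); ring.
lra.
Qed.

Lemma sandwich_abs_diff F G : sandwich F G b -> forall w u,
  `|F u - F w| <= norm2 (G w) * norm2 (u - w) + b * norm2 (u - w) ^+ 2.
Proof.
move=> sF w u; have /andP[h1 h2] := sF w u.
have := dotv_le_norm2 (G w) (u - w); have := dotv_le_norm2 (G w) (- (u - w)).
rewrite norm2N dotvNr => h3 h4.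
have : 0 <= b * norm2 (u - w) ^+ 2 by rewrite mulr_ge0 ?sqr_ge0// ltW.
by move=> h5; rewrite ler_norml; apply/andP; split; lra.
Qed.

Lemma sandwich_mean (n : nat) (f : 'I_n -> 'rV[R]_d -> R) (g : 'I_n -> 'rV[R]_d -> 'rV[R]_d) :
  (0 < n)%N -> (forall j, sandwich (f j) (g j) b) ->
  sandwich (fun w => n%:R^-1 * \sum_(j < n) f j w)
           (fun w => n%:R^-1 *: \sum_(j < n) g j w) b.
Proof.
move=> n0 sf w u; rewrite dotvZl dotv_suml -mulrDr -big_split/=.
have n0' : (0 : R) < n%:R by rewrite ltr0n.
have -> : b * norm2 (u - w) ^+ 2 = n%:R^-1 * \sum_(j < n) (b * norm2 (u - w) ^+ 2).
  by rewrite sumr_const card_ord -(mulr_natl (b * _) n) mulKf// gt_eqF.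
rewrite -mulrDr -big_split/=; apply/andP; split; rewrite ler_pM2l ?invr_gt0//;
  apply: ler_sum => j _; by have /andP[] := sf j w u.
Qed.

End sandwich_theory.

(** * Regret and stability of gradient descent *)

Lemma sqr_sum_le {R : realType} (m : nat) (a : nat -> R) :
  (\sum_(k < m) a k) ^+ 2 <= m%:R * \sum_(k < m) a k ^+ 2.
Proof.
elim: m => [|m IH]; first by rewrite !big_ord0 expr2 !mul0r.
rewrite !big_ord_recr/= sqrrD mulrDr -[m.+1]addn1 natrD !mulrDl !mul1r.
have : (\sum_(k < m) a k) * a m *+ 2 <= \sum_(k < m) a k ^+ 2 + m%:R * a m ^+ 2.
  rewrite -mulrnAr mulr_suml.
  have -> : m%:R * a m ^+ 2 = \sum_(k < m) a m ^+ 2.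
    by rewrite sumr_const card_ord mulr_natl.
  rewrite -big_split/=; apply: ler_sum => k _; have := sqr_ge0 (a k - a m).
  by rewrite sqrrB mulrnAr; lra.
lra.
Qed.

Section gradient_descent.
Context {R : realType} {d : nat} {Z : Type} {n : nat}.
Variables (f : 'rV[R]_d -> Z -> R) (g : 'rV[R]_d -> Z -> 'rV[R]_d) (b : R).
Variable W1 : 'rV[R]_d.
Hypotheses (n0 : (0 < n)%N) (b0 : 0 < b).
Hypothesis f0 : forall w x, 0 <= f w x.
Hypothesis fg : forall x, sandwich (fun w => f w x) (fun w => g w x) b.
Implicit Types (s : 'I_n -> Z).

Let W s := gd_iter g (1 / (2 * b)) W1 s.

Let n0R : (0 : R) < n%:R. Proof. by rewrite ltr0n. Qed.

Let emp_sandwich s :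
  sandwich (emp_risk f s) (fun w => n%:R^-1 *: \sum_(j < n) g w (s j)) b.
Proof.
exact: (sandwich_mean b n (fun j w => f w (s j)) (fun j w => g w (s j)) n0 (fun j => fg (s j))).
Qed.

Let gd_step s k :
  W s k.+1 = W s k - (2 * b)^-1 *: (n%:R^-1 *: \sum_(j < n) g (W s k) (s j)).
Proof. by rewrite /W/= div1r scalerA. Qed.

Lemma emp_risk_ge0 s w : 0 <= emp_risk f s w.
Proof. by rewrite mulr_ge0 ?invr_ge0//; exact: sumr_ge0. Qed.

Let emp_risk_step s u k : emp_risk f s (W s k.+1) <=
  emp_risk f s u + b * norm2 (W s k - u) ^+ 2 - b * norm2 (W s k.+1 - u) ^+ 2.
Proof. by rewrite gd_step; exact: (sandwich_step b b0 _ _ (emp_sandwich s)). Qed.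

Lemma emp_risk_gd_le s k l : (k <= l)%N -> emp_risk f s (W s l) <= emp_risk f s (W s k).
Proof.
elim: l => [|l IH]; first by rewrite leqn0 => /eqP ->.
rewrite leq_eqVlt => /orP[/eqP -> //|/IH]; apply: le_trans.
have := emp_risk_step s (W s l) l; rewrite subrr norm2_0 expr2 mulr0 mulr0 addr0.
move=> /le_trans; apply; rewrite gerBl mulr_ge0 ?sqr_ge0// ltW//.
Qed.

Lemma sum_emp_risk_gdS s u m :
  \sum_(k < m) emp_risk f s (W s k.+1) <=
  m%:R * emp_risk f s u + b * norm2 (W1 - u) ^+ 2.
Proof.
suff : \sum_(k < m) emp_risk f s (W s k.+1) <=
    m%:R * emp_risk f s u + b * norm2 (W1 - u) ^+ 2 - b * norm2 (W s m - u) ^+ 2.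
  by move=> /le_trans; apply; rewrite gerBl mulr_ge0 ?sqr_ge0// ltW.
elim: m => [|m IH]; first by rewrite big_ord0 mul0r add0r subrr.
rewrite big_ord_recr/= -[m.+1]addn1 natrD mulrDl mul1r addn1.
by have := emp_risk_step s u m; lra.
Qed.

(** Telescoping only reaches the iterates after a step, whereas stability sums from [W1] on. The
    risk at [W1] is bounded by the sandwich at the minimiser [u], where the gradient vanishes; this
    costs the second [b * norm2 (W1 - u) ^+ 2]. *)
Lemma sum_emp_risk_gd s u m : (forall w, emp_risk f s u <= emp_risk f s w) ->
  \sum_(k < m) emp_risk f s (W s k) <=
  2 * b * norm2 (W1 - u) ^+ 2 + m%:R * emp_risk f s u.
Proof.
move=> umin; have h0 : 0 <= b * norm2 (W1 - u) ^+ 2 by rewrite mulr_ge0 ?sqr_ge0// ltW.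
case: m => [|m]; first by rewrite big_ord0 mul0r addr0 -mulrA mulr_ge0.
rewrite big_ord_recl/= -[m.+1]addn1 natrD mulrDl mul1r.
have := sum_emp_risk_gdS s u m.
have /andP[_] := emp_sandwich s u W1.
set G := (_ *: _ : 'rV[R]_d).
have G0 : norm2 G = 0.
  have := sandwich_grad_le _ b0 _ _ _ (emp_sandwich s) umin u.
  rewrite subrr mulr0 => h; apply/eqP; rewrite -sqrf_eq0.
  by apply/eqP/le_anti; rewrite h sqr_ge0.
have := dotv_le_norm2 G (W1 - u); rewrite G0 mul0r; rewrite {2}/W/=; lra.
Qed.

Lemma emp_risk_gd_last s u m :
  m%:R * emp_risk f s (W s m) <= m%:R * emp_risk f s u + b * norm2 (W1 - u) ^+ 2.
Proof.
apply: le_trans (sum_emp_risk_gdS s u m).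
have -> : m%:R * emp_risk f s (W s m) = \sum_(k < m) emp_risk f s (W s m).
  by rewrite sumr_const card_ord mulr_natl.
by apply: ler_sum => k _; apply: emp_risk_gd_le.
Qed.

Section stability.
Variables (s s' : 'I_n -> Z) (i : 'I_n).
Hypothesis ss' : forall j, j != i -> s j = s' j.

(* A step averages the [n] one-sample steps, of which all but the [i]-th are
   nonexpansive maps common to both runs. *)
Lemma gd_stability m : norm2 (W s' m - W s m) <= (2 * b * n%:R)^-1 *
  \sum_(k < m) (norm2 (g (W s k) (s i)) + norm2 (g (W s' k) (s' i))).
Proof.
elim: m => [|m IH]; first by rewrite big_ord0 mulr0 subrr norm2_0.
rewrite big_ord_recr/= [leRHS]mulrDr; apply: le_trans (lerD IH (lexx _)).
set A := W s' m; set B := W s m.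
pose S (w : 'rV[R]_d) x := w - (2 * b)^-1 *: g w x.
have avg r : W r m.+1 = n%:R^-1 *: \sum_(j < n) S (W r m) (r j).
  rewrite gd_step scalerA mulrC -scalerA /S.
  rewrite [\sum_(j < n) (_ - _)]sumrB sumr_const card_ord -scaler_sumr scalerBr.
  by rewrite -[W r m *+ n]scaler_nat [n%:R^-1 *: (n%:R *: _)]scalerA mulVf ?scale1r// gt_eqF.
have -> : W s' m.+1 - W s m.+1 = n%:R^-1 *: \sum_(j < n) (S A (s' j) - S B (s j)).
  by rewrite !avg -scalerBr -sumrB.
rewrite norm2Z ger0_norm ?invr_ge0// -ler_pdivlMl ?invr_gt0// invrK mulrDr.
apply: le_trans (norm2_sum _ _ _ _) _.
have -> : n%:R * norm2 (A - B) = \sum_(j < n) norm2 (A - B).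
  by rewrite sumr_const card_ord mulr_natl.
rewrite (bigD1 i)//= [in leRHS](bigD1 i)//= [leRHS]addrAC; apply: lerD; last first.
  apply: ler_sum => j ji; rewrite (ss' _ ji).
  exact: (sandwich_step_nonexpansive _ b0 _ _ (fg (s' j))).
have -> : S A (s' i) - S B (s i) =
    (A - B) + (2 * b)^-1 *: (g B (s i) - g A (s' i)).
  by apply/rowP => l; rewrite !mxE; ring.
apply: le_trans (norm2D _ _) _; rewrite lerD2l norm2Z.
have cE (y : R) : n%:R * ((2 * b * n%:R)^-1 * y) = (2 * b)^-1 * y.
  by field; rewrite !gt_eqF.
rewrite cE ger0_norm ?invr_ge0 ?mulr_ge0 ?(ltW b0)//.
rewrite ler_pM2l ?invr_gt0 ?mulr_gt0//.
by apply: le_trans (norm2D _ _) _; rewrite norm2N.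
Qed.

(** On the left, the run on [s'] is tested at [s i], the point it has lost; on the right, each run
    meets only its own [i]-th point. This asymmetry is what the exchange argument exploits. *)
Lemma gd_loss_stability m :
  `|f (W s' m) (s i) - f (W s m) (s i)| <=
  n%:R^-1 * \sum_(k < m) (2 * f (W s m) (s i) + (f (W s k) (s i) + f (W s' k) (s' i))) +
  2 * m%:R / n%:R ^+ 2 * \sum_(k < m) (f (W s k) (s i) + f (W s' k) (s' i)).
Proof.
apply: le_trans (sandwich_abs_diff _ b0 _ _ (fg (s i)) _ _) _.
have gf w x : norm2 (g w x) ^+ 2 <= 4 * b * f w x.
  by have := sandwich_grad_le _ b0 _ _ 0 (fg x) (f0 ^~ x) w; rewrite subr0.
have := gd_stability m; set D := norm2 (_ - _).
have D0 : 0 <= D by exact: norm2_ge0.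
set p := fun k => norm2 (g (W s k) (s i)).
set q := fun k => norm2 (g (W s' k) (s' i)).
rewrite -/(p _) => hD.
have p0 k : 0 <= p k by exact: norm2_ge0.
have q0 k : 0 <= q k by exact: norm2_ge0.
have c0 : 0 < (2 * b * n%:R)^-1 by rewrite invr_gt0 !mulr_gt0.
apply: lerD.
- apply: le_trans (ler_wpM2l (p0 m) hD) _.
  rewrite mulrCA -ler_pdivlMl//= invrK mulrA.
  have -> : 2 * b * n%:R / n%:R = 2 * b by rewrite mulfK// gt_eqF.
  rewrite !mulr_sumr; apply: ler_sum => k _.
  have := gf (W s k) (s i); have := gf (W s' k) (s' i); have := gf (W s m) (s i).
  rewrite -/(p k) -/(q k) -/(p m) => h1 h2 h3.
  (* Young's inequality on [p m * p k] and [p m * q k]; each square is at most [4 * b] times a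
     loss. *)
  have := sqr_ge0 (p m - p k); have := sqr_ge0 (p m - q k); nra.
- have hD2 : D ^+ 2 <= ((2 * b * n%:R)^-1 * \sum_(k < m) (p k + q k)) ^+ 2.
    by rewrite ler_pXn2r// nnegrE// mulr_ge0 ?(ltW c0)//; apply: sumr_ge0 => k _; rewrite addr_ge0.
  apply: le_trans (ler_wpM2l (ltW b0) hD2) _.
  rewrite exprMn mulrA.
  have bc0 : 0 < b * (2 * b * n%:R)^-1 ^+ 2 by rewrite mulr_gt0// exprn_gt0.
  apply: le_trans (ler_wpM2l (ltW bc0) (sqr_sum_le m (fun k => p k + q k))) _.
  (* The factor [8 * b] is 2 from [(p + q)^2 <= 2 p^2 + 2 q^2] times [4 * b] from [gf]; against
     [b * (2 * b * n)^-2] it leaves [2 / n^2]. *)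
  have -> : 2 * m%:R / n%:R ^+ 2 * \sum_(k < m) (f (W s k) (s i) + f (W s' k) (s' i)) =
    b * (2 * b * n%:R)^-1 ^+ 2 *
      (m%:R * \sum_(k < m) (8 * b * (f (W s k) (s i) + f (W s' k) (s' i)))).
    rewrite -mulr_sumr; field; rewrite !gt_eqF//.
  rewrite ler_pM2l// ler_wpM2l//; apply: ler_sum => k _.
  have := gf (W s k) (s i); have := gf (W s' k) (s' i).
  rewrite -/(p k) -/(q k) => h1 h2.
  have := sqr_ge0 (p k - q k); nra.
Qed.

End stability.
End gradient_descent.

(** * Measurability of the iterates *)

Lemma cvg_dist_le {R : realType} (u e : R^nat) (l : R) :
  (forall k, `|u k - l| <= e k) -> e k @[k --> \oo] --> (0 : R) ->
  u k @[k --> \oo] --> l.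
Proof.
move=> ue e0; apply/cvgrPdist_le => eps eps0.
have /cvgrPdist_le/(_ _ eps0) := e0; apply: filterS => k.
by rewrite sub0r normrN distrC => /(le_trans (ler_norm _)); exact: le_trans.
Qed.

Section caratheodory.
Context {R : realType} {dT dz : measure_display}.
Context {T : measurableType dT} {Z : measurableType dz}.

Lemma measurable_fun_countable_param (C : countType) (m : T -> C) (h : C -> Z -> R)
    (X : T -> Z) :
  (forall c, measurable (m @^-1` [set c])) ->
  (forall c, measurable_fun setT (h c)) -> measurable_fun setT X ->
  measurable_fun setT (fun t => h (m t) (X t)).
Proof.
move=> mm mh mX _ Y mY; rewrite setTI.
have -> : (fun t => h (m t) (X t)) @^-1` Y =
    \bigcup_c (m @^-1` [set c] `&` X @^-1` (h c @^-1` Y)).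
  apply/seteqP; split=> [t Yt|t [c _ [/= <-]]]//.
  by exists (m t).
apply: countable_bigcupT_measurable => [|c]; first exact: countableP.
apply: measurableI => //; rewrite -[X in measurable X]setTI; apply: mX => //.
by rewrite -[X in measurable X]setTI; apply: mh.
Qed.

(* Rounding [W] down to the grid of mesh [1 / k.+1] makes it countably valued. *)
Lemma measurable_fun_caratheodory (d : nat) (h : 'rV[R]_d -> Z -> R)
    (W : T -> 'rV[R]_d) (X : T -> Z) :
  (forall w, measurable_fun setT (h w)) ->
  (forall x w, exists C, forall u,
    `|h u x - h w x| <= C * (norm2 (u - w) + norm2 (u - w) ^+ 2)) ->
  (forall i, measurable_fun setT (fun t => W t ord0 i)) -> measurable_fun setT X ->
  measurable_fun setT (fun t => h (W t) (X t)).
Proof.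
move=> mh ch mW mX.
pose fl (k : nat) (t : T) : {ffun 'I_d -> int} :=
  [ffun i => Num.floor (k.+1%:R * W t ord0 i)].
pose gr (k : nat) (c : {ffun 'I_d -> int}) : 'rV[R]_d :=
  \row_i ((c i)%:~R / k.+1%:R).
apply: (@measurable_fun_cvg _ _ _ _ (fun k t => h (gr k (fl k t)) (X t))) => [k|t _].
  apply: (measurable_fun_countable_param _ (fl k) (fun c => h (gr k c))) => // c.
  have -> : fl k @^-1` [set c] = \bigcap_(i in [set: 'I_d])
      (fun t => W t ord0 i) @^-1` `[(c i)%:~R / k.+1%:R, (c i + 1)%:~R / k.+1%:R[%classic.
    apply/seteqP; split=> t /=.
      move=> <- i _; rewrite /= in_itv/= ffunE.
      rewrite ler_pdivrMr// ltr_pdivlMr// (mulrC (W t ord0 i)) floor_le//.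
      by rewrite floorD1_gt.
    move=> H; apply/ffunP => i; rewrite ffunE; apply/floor_def.
    have := H i Logic.I; rewrite /= in_itv/= ler_pdivrMr// ltr_pdivlMr//.
    by rewrite (mulrC (W t ord0 i)).
  apply: fin_bigcap_measurable => // i _.
  by rewrite -[X in measurable X]setTI; apply: mW.
have [C hC] := ch (X t) (W t).
pose e (k : nat) : R := d%:R * harmonic k.
have e0 : e k @[k --> \oo] --> (0 : R).
  by rewrite -(mulr0 d%:R); apply: cvgMl_tmp; exact: cvg_harmonic.
have near k : norm2 (gr k (fl k t) - W t) <= e k.
  apply: le_trans (norm2_le_sum _) _.
  rewrite /e -[d in d%:R]card_ord mulr_natl -sumr_const; apply: ler_sum => i _.
  rewrite !mxE ffunE distrC.
  have k0 : (0 : R) < k.+1%:R by [].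
  have -> : W t ord0 i - (Num.floor (k.+1%:R * W t ord0 i))%:~R / k.+1%:R =
    (k.+1%:R * W t ord0 i - (Num.floor (k.+1%:R * W t ord0 i))%:~R) * harmonic k.
    by rewrite mulrBl /harmonic/= mulrAC mulfV ?mul1r// gt_eqF.
  rewrite normrM (ger0_norm (harmonic_ge0 k)) ler_piMl// ?harmonic_ge0//.
  rewrite ger0_norm ?subr_ge0 ?floor_le//.
  by rewrite lerBlDl; apply/ltW; rewrite -intrD1 floorD1_gt.
apply: (cvg_dist_le _ (fun k => `|C| * (e k + e k ^+ 2))) => [k|].
  apply: le_trans (hC _) _; apply: le_trans (ler_wpM2r _ (ler_norm C)) _.
    by rewrite addr_ge0 ?sqr_ge0 ?norm2_ge0.
  rewrite ler_wpM2l//; apply: lerD => //.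
  by rewrite ler_pXn2r ?nnegrE ?norm2_ge0 ?(le_trans (norm2_ge0 _) (near k)).
rewrite -(mulr0 `|C|); apply: cvgMl_tmp.
have := cvgD e0 (cvgM e0 e0); rewrite mulr0 addr0. exact.
Qed.

End caratheodory.

Section gradient_descent_measurable.
Context {R : realType} {d : nat} {dz : measure_display} {Z : measurableType dz}.
Variables (f : 'rV[R]_d -> Z -> R) (g : 'rV[R]_d -> Z -> 'rV[R]_d) (b : R).
Hypothesis b0 : 0 < b.
Hypothesis mf : forall w, measurable_fun setT (f w).
Hypothesis fg : forall x, sandwich (fun w => f w x) (fun w => g w x) b.

(** Each partial derivative is a limit of difference quotients of measurable functions; the sandwich
    bounds the error at step [harmonic k] by [b * harmonic k]. *)
Lemma measurable_gradient w i : measurable_fun setT (fun x => g w x ord0 i).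
Proof.
pose v (k : nat) := w + harmonic k *: delta_mx ord0 i.
apply: (@measurable_fun_cvg _ _ _ _ (fun k x => k.+1%:R * (f (v k) x - f w x))) => [k|x _].
  by apply: measurable_funM => //; apply: measurable_funB.
apply: (cvg_dist_le _ (fun k => b * harmonic k)) => [k|]; last first.
  by rewrite -(mulr0 b); apply: cvgMl_tmp; exact: cvg_harmonic.
have k0 : (0 : R) < k.+1%:R by [].
have := fg x w (v k); rewrite /v [_ - w]addrAC subrr add0r.
have e1 : dotv (g w x) (delta_mx ord0 i) = g w x ord0 i.
  rewrite /dotv (bigD1 i)//= mxE !eqxx mulr1 big1 ?addr0// => j ji.
  by rewrite mxE (negbTE ji) andbF mulr0.
have e2 : dotv (delta_mx ord0 i) (delta_mx ord0 i) = 1 :> R.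
  rewrite /dotv (bigD1 i)//= mxE !eqxx mulr1 big1 ?addr0// => j ji.
  by rewrite mxE (negbTE ji) andbF mulr0.
rewrite norm2_sq !dotvE e1 e2 mulr1 => /andP[h1 h2].
rewrite -(ler_pM2l (harmonic_gt0 k)) -{1}(gtr0_norm (harmonic_gt0 k)) -normrM.
have -> : harmonic k *
    (k.+1%:R * (f (w + harmonic k *: delta_mx ord0 i) x - f w x) - g w x ord0 i) =
    f (w + harmonic k *: delta_mx ord0 i) x - f w x - harmonic k * g w x ord0 i.
  by rewrite mulrBr mulrA mulVf ?gt_eqF// mul1r.
by rewrite ler_norml; apply/andP; split; have := mulr_ge0 (ltW b0) (sqr_ge0 (harmonic k : R)); lra.
Qed.

Context {dT : measure_display} {T : measurableType dT}.

Lemma measurable_loss (W : T -> 'rV[R]_d) (X : T -> Z) :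
  (forall i, measurable_fun setT (fun t => W t ord0 i)) -> measurable_fun setT X ->
  measurable_fun setT (fun t => f (W t) (X t)).
Proof.
apply: measurable_fun_caratheodory => // x w; exists (norm2 (g w x) + b) => u.
apply: le_trans (sandwich_abs_diff _ b0 _ _ (fg x) _ _) _.
have := norm2_ge0 (u - w); have := norm2_ge0 (g w x).
move: (norm2 (g w x)) (norm2 (u - w)) => p q p0 q0.
have := mulr_ge0 p0 (sqr_ge0 q); have := mulr_ge0 (ltW b0) q0; lra.
Qed.

Hypothesis sg : forall x, smooth_with b (fun w => g w x).

Lemma measurable_gd n (eta : R) (W1 : 'rV[R]_d) (s : T -> 'I_n -> Z) :
  (forall j, measurable_fun setT (s ^~ j)) ->
  forall k i, measurable_fun setT (fun t => gd_iter g eta W1 (s t) k ord0 i).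
Proof.
move=> ms; elim=> [|k IH] i /=; first exact: measurable_cst.
rewrite (_ : (fun t => _) = fun t => gd_iter g eta W1 (s t) k ord0 i -
    eta / n%:R * \sum_(j < n) g (gd_iter g eta W1 (s t) k) (s t j) ord0 i); last first.
  by apply/funext => t; rewrite !mxE summxE.
apply: measurable_funB; first exact: IH.
apply: measurable_funM => //; apply: measurable_sum => j.
apply: (measurable_fun_caratheodory _ (fun w x => g w x ord0 i)) => // [w|x w].
  exact: measurable_gradient.
exists b => u; have -> : g u x ord0 i - g w x ord0 i = (g u x - g w x) ord0 i by rewrite !mxE.
apply: le_trans (norm_coord_le_norm2 _ _) _; apply: le_trans (sg _ _ _) _.
by rewrite ler_pM2l// lerDl sqr_ge0.
Qed.

End gradient_descent_measurable.

(** * Exchanging a sample point with its independent copy *)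

Section boxes.
Context {dz : measure_display} {Z : measurableType dz} (I : finType).

Definition boxes : set (set (I -> Z)) :=
  [set B | exists2 A : I -> set Z, (forall i, measurable (A i)) &
    B = [set s | forall i, A i (s i)]].

(** The product sigma-algebra on [I -> Z]. Its generating boxes are stable under intersection, so a
    probability law on it is determined by boxes. *)
Definition sample_space : Type := g_sigma_algebraType boxes.
HB.instance Definition _ := Measurable.on sample_space.

Lemma setI_closed_boxes : setI_closed boxes.
Proof.
move=> _ _ [A mA ->] [B mB ->]; exists (fun i => A i `&` B i).
  by move=> i; exact: measurableI.
apply/seteqP; split=> [s [sA sB] i|s sAB]; first by split.
by split=> i; have [] := sAB i.
Qed.

Lemma boxesT : boxes setT.
Proof. by exists (fun=> setT) => //; apply/seteqP; split. Qed.

Lemma measurable_coord i : measurable_fun setT (fun s : sample_space => s i).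
Proof.
move=> _ Y mY; rewrite setTI; apply: sub_sigma_algebra.
exists (fun j => if j == i then Y else setT) => [j|]; first by case: ifP.
apply/seteqP; split=> [s /= sY j|s /= /(_ i)]; last by rewrite eqxx.
by case: eqP => // ->.
Qed.

Context {R : realType} {dT : measure_display} {T : measurableType dT}.

Lemma measurable_sample (phi : T -> sample_space) :
  (forall i, measurable_fun setT (fun t => phi t i)) -> measurable_fun setT phi.
Proof.
move=> mphi; apply: (@measurability _ _ T sample_space setT phi boxes) => //.
move=> _ [_ [A mA ->] <-]; rewrite setTI.
have -> : phi @^-1` [set s | forall i, A i (s i)] =
    \bigcap_(i in [set: I]) (fun t => phi t i) @^-1` A i.
  by apply/seteqP; split=> [t tA i _|t tA i]; exact: tA.
apply: fin_bigcap_measurable => // i _.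
by rewrite -[X in measurable X]setTI; exact: mphi.
Qed.

(** The two pushforwards are finite measures that agree on a generating pi-system containing [setT],
    hence are equal. *)
Lemma ge0_integral_eq_law (P : probability T R) (phi psi : T -> sample_space)
    (F : sample_space -> \bar R) :
  measurable_fun setT phi -> measurable_fun setT psi ->
  (forall A : I -> set Z, (forall i, measurable (A i)) ->
    P [set t | forall i, A i (phi t i)] = P [set t | forall i, A i (psi t i)]) ->
  measurable_fun setT F -> (forall s, 0 <= F s)%E ->
  (\int[P]_t F (phi t) = \int[P]_t F (psi t))%E.
Proof.
move=> mphi mpsi eq_box mF F0.
have push chi : measurable_fun setT chi ->
    (\int[P]_t F (chi t) = \int[pushforward P chi]_s F s)%E.
  by move=> mchi; rewrite ge0_integral_pushforward ?preimage_setT.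
rewrite !push//; apply: eq_measure_integral => A mA _.
have cover : \bigcup_(k in [set: nat]) [set: sample_space] = setT.
  by rewrite bigcup_const//; exists 0%N.
apply: (@measure_unique _ R sample_space boxes (fun=> setT) erefl setI_closed_boxes
  (fun=> boxesT) cover (pushforward P phi) (pushforward P psi)) => //.
- by move=> _ [B mB ->]; exact: eq_box.
- by move=> k; rewrite /= /pushforward preimage_setT probability_setT ltry.
Qed.

End boxes.

Section ghost_sample.
Context {R : realType} {dO dz : measure_display}.
Context {Omega : measurableType dO} {Z : measurableType dz} {n : nat}.
Variables (P : probability Omega R) (D : probability Z R) (z : 'I_n -> Omega -> Z).
Hypothesis iid : iid_sample P D z.
Variable i : 'I_n.

(* The sample [z] on the first factor, extended at index [None] by an independent copy
   of [z i] living on the second factor. *)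
Definition ghost (p : Omega * Omega) (o : option 'I_n) : Z :=
  if o is Some j then z j p.1 else z i p.2.

Definition swap_ghost (o : option 'I_n) : option 'I_n :=
  if o is Some j then if j == i then None else Some j else Some i.

Lemma swap_ghostK : involutive swap_ghost.
Proof.
case=> [j|] /=; last by rewrite eqxx.
by case: (eqVneq j i) => [->|/negbTE ji] //=; rewrite ji.
Qed.

Lemma measurable_ghost o : measurable_fun setT (fun p => ghost p o).
Proof.
have [mz _] := iid.
by case: o => [j|] /=; apply: measurableT_comp.
Qed.

(** The extended sample consists of [n + 1] independent draws from [D]. The product is symmetric in
    its factors, which is the source of exchangeability. *)
Lemma ghost_boxE (A : option 'I_n -> set Z) : (forall o, measurable (A o)) ->
  (P \x P)%E [set p | forall o, A o (ghost p o)] = (\prod_o D (A o))%E.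
Proof.
have [mz [indep law]] := iid => mA.
have mzA j o : measurable (z j @^-1` A o).
  by rewrite -[X in measurable X]setTI; exact: mz.
have -> : [set p | forall o, A o (ghost p o)] =
    (\bigcap_(j in [set: 'I_n]) (z j @^-1` A (Some j))) `*` (z i @^-1` A None).
  apply/seteqP; split=> [p pA|p [pA pN] [j|//]]; last exact: pA.
  by split=> [j _|]; [exact: (pA (Some j))|exact: (pA None)].
rewrite product_measure1E//; last exact: fin_bigcap_measurable.
have /= -> := indep (fun j => A (Some j)) (fun j => mA _).
rewrite law// (bigD1 None)//= muleC; congr (_ * _)%E.
rewrite (reindex_omap Some id)//=; last by case.
by apply: eq_big => [j|j _]; [rewrite eqxx|rewrite law].
Qed.

Lemma ghost_exchange (F : sample_space (option 'I_n) -> \bar R) :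
  measurable_fun setT F -> (forall s, 0 <= F s)%E ->
  (\int[P \x P]_p F (ghost p) = \int[P \x P]_p F (ghost p \o swap_ghost))%E.
Proof.
move=> mF F0.
have mg : measurable_fun setT (ghost : _ -> sample_space (option 'I_n)).
  by apply: measurable_sample => o; exact: measurable_ghost.
have ms : measurable_fun setT (fun p => ghost p \o swap_ghost : sample_space (option 'I_n)).
  by apply: measurable_sample => o; exact: measurable_ghost.
apply: ge0_integral_eq_law => // A mA.
transitivity (\prod_o D (A o))%E; first exact: ghost_boxE.
transitivity (\prod_o D (A (swap_ghost o)))%E.
  by rewrite (reindex_inj (inv_inj swap_ghostK)).
rewrite -ghost_boxE//; congr ((P \x P)%E _).
apply/seteqP; split=> p /= pA o; last by have := pA (swap_ghost o); rewrite swap_ghostK.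
by rewrite -[in A _](swap_ghostK o); exact: pA.
Qed.

End ghost_sample.

(** * Expectations *)

Section mean.
Context {R : realType} {d : measure_display} {T : measurableType d}.
Implicit Types (X Y : T -> R) (m : R).

(** Bundling nonnegativity with a real-valued integral makes each mean carry its own integrability
    proof. *)
Definition has_mean (mu : {measure set T -> \bar R}) X m :=
  [/\ measurable_fun setT X, forall t, 0 <= X t & (\int[mu]_t (X t)%:E = m%:E)%E].

Variable mu : {measure set T -> \bar R}.

Lemma has_meanD X Y m m' : has_mean mu X m -> has_mean mu Y m' ->
  has_mean mu (fun t => X t + Y t) (m + m').
Proof.
move=> [mX X0 eX] [mY Y0 eY]; split=> [|t|]; first exact: measurable_funD.
  exact: addr_ge0.
under eq_integral do rewrite EFinD.
by rewrite ge0_integralD ?eX ?eY//; try (by move=> t _; rewrite lee_fin);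
  exact/measurable_EFinP.
Qed.

Lemma has_meanZ (c : R) X m : 0 <= c -> has_mean mu X m ->
  has_mean mu (fun t => c * X t) (c * m).
Proof.
move=> c0 [mX X0 eX]; split=> [|t|]; first exact: measurable_funM.
  exact: mulr_ge0.
under eq_integral do rewrite EFinM.
rewrite ge0_integralZl ?eX//; first exact/measurable_EFinP.
by move=> t _; rewrite lee_fin.
Qed.

Lemma has_mean0 : has_mean mu (fun=> 0) 0.
Proof. by split=> //; rewrite integral0. Qed.

Lemma has_mean_sum k (X : 'I_k -> T -> R) (m : 'I_k -> R) :
  (forall i, has_mean mu (X i) (m i)) ->
  has_mean mu (fun t => \sum_(i < k) X i t) (\sum_(i < k) m i).
Proof.
elim: k X m => [|k IH] X m h.
  rewrite big_ord0 (_ : (fun t => _) = fun=> 0); first exact: has_mean0.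
  by apply/funext => t; rewrite big_ord0.
rewrite big_ord_recl (_ : (fun t => _) = fun t => X ord0 t + \sum_(i < k) X (lift ord0 i) t).
  by apply: has_meanD => //; exact: IH.
by apply/funext => t; rewrite big_ord_recl.
Qed.

Lemma has_mean_le X Y m m' : (forall t, X t <= Y t) ->
  has_mean mu X m -> has_mean mu Y m' -> m <= m'.
Proof.
move=> XY [mX X0 eX] [mY Y0 eY]; rewrite -lee_fin -eX -eY.
by apply: ge0_le_integral => //; try (by move=> t _; rewrite lee_fin);
  exact/measurable_EFinP.
Qed.

Lemma has_mean_ge0 X m : has_mean mu X m -> 0 <= m.
Proof.
by move=> [mX X0 eX]; rewrite -lee_fin -eX; apply: integral_ge0 => t _; rewrite lee_fin.
Qed.

Lemma has_mean_integrable X m : has_mean mu X m -> mu.-integrable setT (EFin \o X).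
Proof.
move=> [mX X0 eX]; apply/integrableP; split; first exact/measurable_EFinP.
rewrite (eq_integral (EFin \o X)) ?eX ?ltry// => t _.
by rewrite gee0_abs//= lee_fin.
Qed.

Lemma has_mean_fin X : measurable_fun setT X -> (forall t, 0 <= X t) ->
  (\int[mu]_t (X t)%:E < +oo)%E -> has_mean mu X (fine (\int[mu]_t (X t)%:E)%E).
Proof.
move=> mX X0 fX; split=> //; rewrite fineK// ge0_fin_numE//.
by apply: integral_ge0 => t _; rewrite lee_fin.
Qed.

Lemma has_mean_dom X Y m : measurable_fun setT X -> (forall t, 0 <= X t) ->
  (forall t, X t <= Y t) -> has_mean mu Y m -> exists m', has_mean mu X m'.
Proof.
move=> mX X0 XY [mY Y0 eY]; exists (fine (\int[mu]_t (X t)%:E)%E).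
apply: has_mean_fin => //; apply: (@le_lt_trans _ _ (m%:E)); last exact: ltry.
rewrite -eY; apply: ge0_le_integral => //; try (by move=> t _; rewrite lee_fin);
  exact/measurable_EFinP.
Qed.

End mean.

Lemma has_mean_cst {R : realType} {d : measure_display} {T : measurableType d}
  (P : probability T R) (c : R) : 0 <= c -> has_mean P (fun=> c) c.
Proof.
move=> c0; split=> //.
by rewrite integral_cst// [X in (_ * X)%E]probability_setT mule1.
Qed.

(** * Expected generalization gap at one sample point *)

Section generalization.
Context {R : realType} {d n : nat} {dz dO : measure_display}.
Context {Z : measurableType dz} {Omega : measurableType dO}.
Variables (P : probability Omega R) (D : probability Z R) (z : 'I_n -> Omega -> Z).
Variables (f : 'rV[R]_d -> Z -> R) (g : 'rV[R]_d -> Z -> 'rV[R]_d) (b : R).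
Variable W1 : 'rV[R]_d.
Hypotheses (n0 : (0 < n)%N) (b0 : 0 < b).
Hypothesis iid : iid_sample P D z.
Hypothesis f0 : forall w x, 0 <= f w x.
Hypothesis mf : forall w, measurable_fun setT (f w).
Hypothesis fg : forall x, sandwich (fun w => f w x) (fun w => g w x) b.
Hypothesis sg : forall x, smooth_with b (fun w => g w x).

Let W (s : 'I_n -> Z) k := gd_iter g (1 / (2 * b)) W1 s k.
Let S om := fun j => z j om.
Let mz j : measurable_fun setT (z j). Proof. by have [] := iid. Qed.

Lemma measurable_gd_loss k j : measurable_fun setT (fun om => f (W (S om) k) (z j om)).
Proof.
apply: (measurable_loss f g b) => // i.
exact: (measurable_gd f g b).
Qed.

Lemma integral_loss_sample j w :
  (\int[P]_om (f w (z j om))%:E = \int[D]_x (f w x)%:E)%E.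
Proof.
have [_ [_ law]] := iid.
transitivity (\int[pushforward P (z j)]_x (f w x)%:E)%E.
  rewrite ge0_integral_pushforward ?preimage_setT//; first exact/measurable_EFinP.
  by move=> x _; rewrite lee_fin.
by apply: eq_measure_integral => A mA _; exact: law.
Qed.

Lemma has_mean_sample j w m : has_mean D (f w) m -> has_mean P (fun om => f w (z j om)) m.
Proof.
move=> [_ _ fm]; split=> //; first exact: measurableT_comp.
by rewrite integral_loss_sample.
Qed.

(** The run sees only the indices [Some j]: [o := Some i] gives a training loss, [o := None] the
    loss at a fresh point. *)
Let L k o (s : @sample_space _ Z (option 'I_n)) : R := f (W (s \o Some) k) (s o).

Let mL k o : measurable_fun setT (L k o).
Proof.
apply: (measurable_loss f g b) => //; last exact: measurable_coord.
move=> i; apply: (measurable_gd f g b) => // j.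
exact: measurable_coord.
Qed.

Variable i : 'I_n.

Let pop_riskE w : pop_risk D f w = (\int[P]_om (f w (z i om))%:E)%E.
Proof. by rewrite integral_loss_sample. Qed.

Let mghost (X : @sample_space _ Z (option 'I_n) -> R) : measurable_fun setT X ->
  measurable_fun setT (fun p => X (ghost z i p)).
Proof.
move=> mX; apply: (measurableT_comp mX); apply: measurable_sample => o.
exact: (measurable_ghost P D z iid).
Qed.

Let mswap (X : @sample_space _ Z (option 'I_n) -> R) : measurable_fun setT X ->
  measurable_fun setT (fun p => X (ghost z i p \o swap_ghost i)).
Proof.
move=> mX; apply: (measurableT_comp mX); apply: measurable_sample => o.
exact: (measurable_ghost P D z iid).
Qed.

Let has_mean_swap (X : @sample_space _ Z (option 'I_n) -> R) m :
  has_mean (P \x P)%E (fun p => X (ghost z i p)) m ->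
  measurable_fun setT X -> (forall s, 0 <= X s) ->
  has_mean (P \x P)%E (fun p => X (ghost z i p \o swap_ghost i)) m.
Proof.
move=> [_ _ e] mX X0; split=> //; first exact: mswap.
rewrite -e; apply/esym.
apply: (ghost_exchange P D z iid i (EFin \o X)); first exact/measurable_EFinP.
by move=> s; rewrite lee_fin.
Qed.

Let has_mean_ghost k m : has_mean P (fun om => f (W (S om) k) (z i om)) m ->
  has_mean (P \x P)%E (fun p => L k (Some i) (ghost z i p)) m.
Proof.
move=> [_ _ e]; split=> [|p|]; [exact: mghost|exact: f0|].
rewrite fubini_tonelli1/=; last 2 first.
- by apply/measurable_EFinP; exact: mghost.
- by move=> p; rewrite lee_fin f0.
rewrite -e; apply: eq_integral => om _.
rewrite /fubini_F/= (eq_integral (cst (f (W (S om) k) (z i om))%:E))//.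
by rewrite integral_cst// [X in (_ * X)%E]probability_setT mule1.
Qed.

(** The population risk of an iterate is the inner Tonelli integral of the loss at the fresh
    point. *)
Lemma measurable_gd_pop_risk k : measurable_fun setT (fun om => pop_risk D f (W (S om) k)).
Proof.
rewrite (_ : (fun om => _) = fubini_F P (fun p => (L k None (ghost z i p))%:E)).
  apply: measurable_fun_fubini_tonelli_F => [|p]; last by rewrite lee_fin f0.
  by apply/measurable_EFinP; exact: mghost.
by apply/funext => om; rewrite pop_riskE.
Qed.

Let pop_risk_ghost k :
  (\int[P]_om pop_risk D f (W (S om) k) = \int[P \x P]_p (L k None (ghost z i p))%:E)%E.
Proof.
rewrite fubini_tonelli1/=; last 2 first.
- by apply/measurable_EFinP; exact: mghost.
- by move=> p; rewrite lee_fin f0.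
by apply: eq_integral => om _; rewrite pop_riskE.
Qed.

(** After the swap, the loss at [None] is that of the perturbed run at the original [z i], so the
    pointwise stability bound compares it with the training loss. Both runs have mean training loss
    [e k] at their own [i]-th point, whence the terms [e k + e k]. *)
Lemma gd_sample_gap (T : nat) (e : nat -> R) :
  (forall k, has_mean P (fun om => f (W (S om) k) (z i om)) (e k)) ->
  exists2 a, (\int[P]_om pop_risk D f (W (S om) T) = a%:E)%E &
    `|a - e T| <= n%:R^-1 * \sum_(k < T) (2 * e T + (e k + e k)) +
                 2 * T%:R / n%:R ^+ 2 * \sum_(k < T) (e k + e k).
Proof.
move=> he.
have hu k := has_mean_ghost k _ (he k).
have hu' k := has_mean_swap _ _ (hu k) (mL k (Some i)) (fun s => f0 _ _).
pose G p := n%:R^-1 * \sum_(k < T) (2 * L T (Some i) (ghost z i p) +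
      (L k (Some i) (ghost z i p) + L k (Some i) (ghost z i p \o swap_ghost i))) +
    2 * T%:R / n%:R ^+ 2 * \sum_(k < T) (L k (Some i) (ghost z i p) +
      L k (Some i) (ghost z i p \o swap_ghost i)).
pose gam := n%:R^-1 * \sum_(k < T) (2 * e T + (e k + e k)) +
    2 * T%:R / n%:R ^+ 2 * \sum_(k < T) (e k + e k).
have hG : has_mean (P \x P)%E G gam.
  apply: has_meanD; apply: has_meanZ; rewrite ?invr_ge0 ?divr_ge0 ?mulr_ge0 ?exprn_ge0//;
    apply: has_mean_sum => k; last exact: has_meanD.
  by apply: has_meanD; [exact: has_meanZ|exact: has_meanD].
have gap p : `|L T None (ghost z i p \o swap_ghost i) - L T (Some i) (ghost z i p)| <= G p.
  have := gd_loss_stability f g b W1 n0 b0 f0 fg (ghost z i p \o Some)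
    (ghost z i p \o swap_ghost i \o Some) i _ T.
  rewrite /G /L /=; apply => j ji.
  by rewrite /= (negbTE ji).
(* Stability dominates the fresh-point loss by [L T (Some i) + G], which makes the expected
   population risk finite. *)
have [a ha] : exists a, has_mean (P \x P)%E (fun p => L T None (ghost z i p \o swap_ghost i)) a.
  apply: has_mean_dom (has_meanD _ _ _ _ _ (hu T) hG) => [|p|p].
  - exact: mswap.
  - exact: f0.
  - by have := gap p; rewrite ler_norml => /andP[_]; lra.
exists a.
  rewrite pop_risk_ghost; have [_ _ <-] := ha.
  apply: (ghost_exchange P D z iid i (EFin \o L T None)); first exact/measurable_EFinP.
  by move=> s; rewrite lee_fin f0.
have h1 : a <= e T + gam.
  apply: has_mean_le ha (has_meanD _ _ _ _ _ (hu T) hG) => p.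
  by have := gap p; rewrite ler_norml => /andP[_]; lra.
have h2 : e T <= a + gam.
  apply: has_mean_le (hu T) (has_meanD _ _ _ _ _ ha hG) => p.
  by have := gap p; rewrite ler_norml => /andP[+ _]; lra.
by rewrite -/gam ler_norml; apply/andP; split; lra.
Qed.

End generalization.

(** Young's inequality on the linear term, followed by [|grad f|^2 <= 4 b f]. Finite risk at one
    point thus implies finite risk at every other. *)
Lemma sandwich_le_affine {R : realType} {d : nat} {Z : Type}
    (f : 'rV[R]_d -> Z -> R) (g : 'rV[R]_d -> Z -> 'rV[R]_d) (b : R) :
  0 < b -> (forall w x, 0 <= f w x) ->
  (forall x, sandwich (fun w => f w x) (fun w => g w x) b) ->
  forall w u x, f u x <= (1 + 2 * b) * f w x + (2^-1 + b) * norm2 (u - w) ^+ 2.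
Proof.
move=> b0 f0 fg w u x; have /andP[_] := fg x w u.
have := sandwich_grad_le _ b0 _ _ 0 (fg x) (f0 ^~ x) w.
have := dotv_le_norm2 (g w x) (u - w).
have := sqr_ge0 (norm2 (g w x) - norm2 (u - w)).
by rewrite subr0 sqrrB mulr2n; lra.
Qed.

(** * Averaging over the sample points and comparison with the empirical minimum *)

Theorem theorem12 (R : realType) (d : nat) (dz dO : measure_display)
  (Z : measurableType dz) (Omega : measurableType dO)
  (P : probability Omega R) (D : probability Z R) (n T : nat)
  (z : 'I_n -> Omega -> Z) (f : 'rV[R]_d -> Z -> R)
  (g : 'rV[R]_d -> Z -> 'rV[R]_d) (beta : R) (W1 wstar : 'rV[R]_d)
  (WS : Omega -> 'rV[R]_d) :
  (0 < n)%N -> (0 < T)%N -> 0 < beta ->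
  iid_sample P D z ->
  (forall w x, 0 <= f w x) ->
  (forall w, measurable_fun setT (f w)) ->
  (forall x, convex_function setT (fun w => f w x)) ->
  (forall x, is_gradient (fun w => f w x) (fun w => g w x)) ->
  (forall x, smooth_with beta (fun w => g w x)) ->
  (forall w, pop_risk D f wstar <= pop_risk D f w)%E ->
  (pop_risk D f wstar < +oo)%E ->
  (forall om w, emp_risk f (fun j => z j om) (WS om)
                <= emp_risk f (fun j => z j om) w) ->
  (forall i, measurable_fun setT (fun om => WS om ord0 i)) ->
  let S om := fun j => z j om in
  let A om := gd_iter g (1 / (2 * beta)) W1 (S om) T in
  let eps_gen := (\int[P]_om (pop_risk D f (A om) - (emp_risk f (S om) (A om))%:E))%E in
  let eps_excess := (\int[P]_om pop_risk D f (A om) - pop_risk D f wstar)%E in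
  let eps_c := (\int[P]_om (emp_risk f (S om) (WS om))%:E)%E in
  let Edist := (\int[P]_om ((norm2 (W1 - WS om)) ^+ 2)%:E)%E in
  let B := ((8 * (n%:R^-1 + 2 * T%:R / n%:R ^+ 2))%:E
              * ((3 * beta)%:E * Edist + (T%:R)%:E * eps_c))%E in
  (`|eps_gen| <= B)%E /\ (eps_excess <= B + (3 * beta / T%:R)%:E * Edist)%E.
Proof.
move=> n0 T0 b0 iid f0 mf cf gf sg _ fin_star WSmin mWS S A eps_gen eps_excess eps_c Edist B.
have fg x : sandwich (fun w => f w x) (fun w => g w x) beta by exact: convex_smooth_sandwich.
have [mz _] := iid.
have n0R : (0 : R) < n%:R by rewrite ltr0n.
have T0R : (0 : R) < T%:R by rewrite ltr0n.
pose W om k := gd_iter g (1 / (2 * beta)) W1 (S om) k.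
have mean_emp (V : Omega -> 'rV[R]_d) (e : 'I_n -> R) :
    (forall j, has_mean P (fun om => f (V om) (z j om)) (e j)) ->
    has_mean P (fun om => emp_risk f (S om) (V om)) (n%:R^-1 * \sum_(j < n) e j).
  by move=> he; apply: has_meanZ; [rewrite invr_ge0|exact: has_mean_sum].
have hstar : has_mean D (f wstar) (fine (pop_risk D f wstar)) by exact: has_mean_fin.
set rho := fine _ in hstar.
have rhoE : pop_risk D f wstar = rho%:E by have [_ _] := hstar.
have emp_star : has_mean P (fun om => emp_risk f (S om) wstar) rho.
  have := mean_emp (fun=> wstar) (fun=> rho)
    (fun j => has_mean_sample P D z f iid f0 mf j _ _ hstar).
  by rewrite sumr_const card_ord -[rho *+ n]mulr_natl mulKf// gt_eqF.
have [m1 hm1] : exists m, has_mean D (f W1) m.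
  apply: has_mean_dom (has_meanD _ _ _ _ _
    (has_meanZ _ (1 + 2 * beta) _ _ _ hstar)
    (has_mean_cst D ((2^-1 + beta) * norm2 (W1 - wstar) ^+ 2) _)) => //.
  - by move=> x; exact: sandwich_le_affine.
  - by rewrite addr_ge0// mulr_ge0// ltW.
  - by rewrite mulr_ge0 ?sqr_ge0// addr_ge0// ltW.
have hm1z j := has_mean_sample P D z f iid f0 mf j _ _ hm1.
have mloss k j : measurable_fun setT (fun om => f (W om k) (z j om)).
  exact: (measurable_gd_loss P D z f g beta).
(* By nonnegativity a single loss is at most the sum over the sample, which descent bounds by its
   value at [W1]. *)
have /choice[e he] (kj : nat * 'I_n) :
    exists m, has_mean P (fun om => f (W om kj.1) (z kj.2 om)) m.
  case: kj => k j /=; apply: has_mean_dom (has_mean_sum _ _ _ _ hm1z) => [|om|om] //.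
  have := emp_risk_gd_le f g beta W1 n0 b0 fg (S om) 0 k (leq0n k).
  rewrite /emp_risk ler_pM2l ?invr_gt0// => h; apply: le_trans h.
  by rewrite (bigD1 j)//= lerDl sumr_ge0.
pose r k := n%:R^-1 * \sum_(j < n) e (k, j).
have hr k : has_mean P (fun om => emp_risk f (S om) (W om k)) (r k).
  exact: (mean_emp (W^~ k) (fun j => e (k, j)) (fun j => he (k, j))).
have gap j := gd_sample_gap P D z f g beta W1 n0 b0 iid f0 mf fg sg j T
  (fun k => e (k, j)) (fun k => he (k, j)).
have [alpha alphaE _] := gap (Ordinal n0).
pose s := \sum_(k < T) r k.
have r_last : T%:R * r T <= s.
  have -> : T%:R * r T = \sum_(k < T) r T by rewrite sumr_const card_ord mulr_natl.
  apply: ler_sum => k _; apply: has_mean_le (hr T) (hr k) => om.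
  by apply: emp_risk_gd_le => //; exact: ltnW.
have gen : `|alpha - r T| <= (4 * n%:R^-1 + 4 * T%:R / n%:R ^+ 2) * s.
  (* All [j] share the same [alpha], the expected population risk; only the training terms depend on
     [j]. *)
  have {}gap j : `|alpha - e (T, j)| <=
      n%:R^-1 * \sum_(k < T) (2 * e (T, j) + (e (k : nat, j) + e (k : nat, j))) +
      2 * T%:R / n%:R ^+ 2 * \sum_(k < T) (e (k : nat, j) + e (k : nat, j)).
    by have [a] := gap j; rewrite alphaE => -[->].
  have -> : alpha - r T = n%:R^-1 * \sum_(j < n) (alpha - e (T, j)).
    by rewrite sumrB sumr_const card_ord mulrBr -[alpha *+ n]mulr_natl mulKf// gt_eqF.
  rewrite normrM ger0_norm ?invr_ge0//.
  apply: (@le_trans _ _ (n%:R^-1 * \sum_(j < n) (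
      n%:R^-1 * \sum_(k < T) (2 * e (T, j) + (e (k : nat, j) + e (k : nat, j))) +
      2 * T%:R / n%:R ^+ 2 * \sum_(k < T) (e (k : nat, j) + e (k : nat, j))))).
    rewrite ler_wpM2l ?invr_ge0//; apply: le_trans (ler_norm_sum _ _ _) _.
    by apply: ler_sum.
  rewrite big_split/= mulrDr -!mulr_sumr.
  have e2 : n%:R^-1 * \sum_(j < n) \sum_(k < T) (e (k : nat, j) + e (k : nat, j)) = 2 * s.
    rewrite exchange_big/= /s !mulr_sumr; apply: eq_bigr => k _.
    by rewrite big_split/= /r; ring.
  have e1 : n%:R^-1 * \sum_(j < n) \sum_(k < T) (2 * e (T, j) + (e (k : nat, j) + e (k : nat, j))) =
      2 * (T%:R * r T) + 2 * s.
    under eq_bigr do rewrite big_split/=.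
    rewrite big_split/= mulrDr e2; congr (_ + _).
    rewrite (eq_bigr (fun j => T%:R * 2 * e (T, j))) => [|j _].
      by rewrite -mulr_sumr /r; ring.
    by rewrite sumr_const card_ord -[RHS]mulrA [RHS]mulr_natl.
  rewrite e1 [n%:R^-1 * (_ / _ * _)]mulrCA e2.
  (* By [r_last]: the last iterate has the smallest expected empirical risk. *)
  have : n%:R^-1 * (2 * (T%:R * r T) + 2 * s) <= n%:R^-1 * (4 * s).
    by rewrite ler_pM2l ?invr_gt0//; lra.
  lra.
have s0 : 0 <= s by apply: sumr_ge0 => k _; exact: has_mean_ge0 (hr k).
have egen : eps_gen = (alpha - r T)%:E.
  have [_ _ emp_eq] := hr T.
  rewrite /eps_gen integralB//; last exact: (has_mean_integrable _ _ _ (hr T)).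
    by rewrite alphaE [X in (_ - X)%E]emp_eq.
  apply/integrableP; split.
    exact: (measurable_gd_pop_risk P D z f g beta W1 b0 iid f0 mf fg sg (Ordinal n0)).
  rewrite (eq_integral (fun om => pop_risk D f (A om))) ?alphaE ?ltry// => om _.
  by rewrite gee0_abs//; apply: integral_ge0 => x _; rewrite lee_fin.
have eexc : eps_excess = (alpha - rho)%:E by rewrite /eps_excess alphaE rhoE.
rewrite egen eexc.
have mdist : measurable_fun setT (fun om => norm2 (W1 - WS om) ^+ 2).
  rewrite (_ : (fun om => _) = fun om => \sum_(i < d) (W1 ord0 i - WS om ord0 i) ^+ 2).
    apply: measurable_sum => i; apply: measurable_funX.
    by apply: measurable_funB; [exact: measurable_cst|exact: mWS].
  apply/funext => om; rewrite norm2_sq; apply: eq_bigr => i _.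
  by rewrite !mxE -expr2.
have [c hc] : exists c, has_mean P (fun om => emp_risk f (S om) (WS om)) c.
  apply: has_mean_dom emp_star => [|om|om]; last exact: WSmin.
    apply: measurable_funM => //; apply: measurable_sum => j.
    by apply: (measurable_loss f g beta) => //; exact: mz.
  exact: emp_risk_ge0.
(* The expected empirical minimum is at most the expected empirical risk of [wstar], which is the
   optimal risk. *)
have c_rho : c <= rho by apply: has_mean_le hc emp_star => om; exact: WSmin.
have ecE : eps_c = c%:E by have [_ _] := hc.
have c0 := has_mean_ge0 _ _ _ hc.
have K0 : 0 < n%:R^-1 + 2 * T%:R / n%:R ^+ 2 :> R.
  by rewrite addr_gt0 ?invr_gt0// divr_gt0 ?exprn_gt0 ?mulr_gt0.
(* An infinite expected squared distance makes both right-hand sides [+oo], because its coefficients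
   are positive. *)
have [Einf|Efin] := eqVneq Edist +oo%E.
  have BE : B = +oo%E.
    by rewrite /B ecE Einf gt0_muley ?lte_fin ?mulr_gt0// addye// gt0_muley// lte_fin mulr_gt0.
  rewrite BE Einf gt0_muley ?lte_fin ?divr_gt0 ?mulr_gt0//.
  by split; exact: leey.
have hd : has_mean P (fun om => norm2 (W1 - WS om) ^+ 2) (fine Edist).
  by apply: has_mean_fin => // [om|]; rewrite ?sqr_ge0// ltey.
set delta := fine _ in hd.
have dE : Edist = delta%:E by have [_ _] := hd.
have d0 := has_mean_ge0 _ _ _ hd.
have s_le : s <= 2 * beta * delta + T%:R * c.
  apply: has_mean_le (has_mean_sum _ _ _ _ (fun k : 'I_T => hr k))
    (has_meanD _ _ _ _ _ (has_meanZ _ (2 * beta) _ _ _ hd) (has_meanZ _ T%:R _ _ _ hc)) => //.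
  - by move=> om; apply: (sum_emp_risk_gd f g) => // w; exact: WSmin.
  - by rewrite mulr_ge0// ltW.
have r_rho : r T <= rho + beta / T%:R * delta.
  rewrite -(ler_pM2l T0R).
  have -> : T%:R * (rho + beta / T%:R * delta) = T%:R * rho + beta * delta.
    by field; rewrite gt_eqF.
  apply: (@le_trans _ _ (T%:R * c + beta * delta)); last by rewrite lerD2r ler_pM2l.
  apply: has_mean_le (has_meanZ _ T%:R _ _ _ (hr T))
    (has_meanD _ _ _ _ _ (has_meanZ _ T%:R _ _ _ hc) (has_meanZ _ beta _ _ _ hd)) => //.
  - by move=> om; exact: (emp_risk_gd_last f g).
  - exact: ltW.
have bd0 : 0 <= beta * delta by rewrite mulr_ge0// ltW.
have Bge : (4 * n%:R^-1 + 4 * T%:R / n%:R ^+ 2) * s <=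
    8 * (n%:R^-1 + 2 * T%:R / n%:R ^+ 2) * (3 * beta * delta + T%:R * c).
  apply: ler_pM => //.
  - have p0 : 0 <= n%:R^-1 :> R by rewrite invr_ge0.
    have q0 : 0 <= T%:R / n%:R ^+ 2 :> R by rewrite divr_ge0 ?exprn_ge0.
    rewrite -!mulrA; lra.
  - by apply: le_trans s_le _; lra.
rewrite /B ecE dE !(=^~ EFinM, =^~ EFinD) !lee_fin; split; first exact: le_trans gen Bge.
(* The excess risk [alpha - rho] splits into the generalization gap [alpha - r T] and the
   optimization error [r T - rho] bounded by [r_rho]. *)
have /ler_normlP[_ gen'] := le_trans gen Bge.
have : beta / T%:R * delta <= 3 * beta / T%:R * delta.
  by rewrite ler_wpM2r// ler_pM2r ?invr_gt0//; lra.
lra.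
Qed.
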